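(* Let $0<\alpha\le 1$, $a,b\in\mathbb{R}$, $\gamma,\beta,\rho,\delta\in\mathbb{C}$ and $p,q>0$ such that $\mathrm{Re}(\gamma)>0$, $\mathrm{Re}(\beta)>0$, $\mathrm{Re}(\rho)>0$, $\mathrm{Re}(\delta)>0$, $\mathrm{Re}(\gamma)+p\ge q$, and let $f,g$ be $\alpha$-differentiable, for $t>0$. Then: (1) ${}_{i}^{\rho}\mathcal{V}_{\gamma,\beta,\alpha}^{\delta,p,q}(af+bg)(t)=a\left({}_{i}^{\rho}\mathcal{V}_{\gamma,\beta,\alpha}^{\delta,p,q}f(t)\right)+b\left({}_{i}^{\rho}\mathcal{V}_{\gamma,\beta,\alpha}^{\delta,p,q}g(t)\right)$. (2) ${}_{i}^{\rho}\mathcal{V}_{\gamma,\beta,\alpha}^{\delta,p,q}(f\cdot g)(t)=f(t)\left({}_{i}^{\rho}\mathcal{V}_{\gamma,\beta,\alpha}^{\delta,p,q}g(t)\right)+g(t)\left({}_{i}^{\rho}\mathcal{V}_{\gamma,\beta,\alpha}^{\delta,p,q}f(t)\right)$. (3) ${}_{i}^{\rho}\mathcal{V}_{\gamma,\beta,\alpha}^{\delta,p,q}\left(\frac{f}{g}\right)(t)=\dfrac{g(t)\left({}_{i}^{\rho}\mathcal{V}_{\gamma,\beta,\alpha}^{\delta,p,q}f(t)\right)-f(t)\left({}_{i}^{\rho}\mathcal{V}_{\gamma,\beta,\alpha}^{\delta,p,q}g(t)\right)}{[g(t)]^2}$. (4) ${}_{i}^{\rho}\mathcal{V}_{\gamma,\beta,\alpha}^{\delta,p,q}(c)=0$,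 where $f(t)=c$ is a constant. (5) (Chain rule) If $f$ is differentiable, then ${}_{i}^{\rho}\mathcal{V}_{\gamma,\beta,\alpha}^{\delta,p,q}f(t)=\dfrac{t^{1-\alpha}\,\Gamma(\beta)\,(\rho)_q}{\Gamma(\gamma+\beta)\,(\delta)_p}\dfrac{df(t)}{dt}$. (6) ${}_{i}^{\rho}\mathcal{V}_{\gamma,\beta,\alpha}^{\delta,p,q}(f\circ g)(t)=f'(g(t))\left({}_{i}^{\rho}\mathcal{V}_{\gamma,\beta,\alpha}^{\delta,p,q}g(t)\right)$, for $f$ differentiable in $g(t)$.
   Context: Here $(\rho)_{s}=\Gamma(\rho+s)/\Gamma(\rho)$ and $(\delta)_{s}=\Gamma(\delta+s)/\Gamma(\delta)$ are (generalized) Pochhammer symbols. The truncated function, with the index $i$ being the upper limit of summation, is $${}_{i}H_{\gamma,\beta,p}^{\rho,\delta,q}(z):=\Gamma(\beta)\sum_{k=0}^{i}\frac{(\rho)_{qk}}{(\delta)_{pk}}\frac{z^k}{\Gamma(\gamma k+\beta)}.$$ For $f:[0,\infty)\to\mathbb{R}$ and $0<\alpha<1$, the truncated $\mathcal{V}$-fractional derivative of $f$ of order $\alpha$ is defined, for all $t>0$, by $${}_{i}^{\rho}\mathcal{V}_{\gamma,\beta,\alpha}^{\delta,p,q}f(t):=\lim_{\epsilon\to 0}\frac{f\big(t\,{}_{i}H_{\gamma,\beta,p}^{\rho,\delta,q}(\epsilon t^{-\alpha})\big)-f(t)}{\epsilon}.$$ If this derivative of order $\alpha$ exists, $f$ is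 said to be $\alpha$-differentiable. The same formula is meant when $\alpha=1$.
   Formalization: Part (5) is stated for truncation index i ≥ 1, since for i = 0 the truncated function is constantly 1, the derivative is 0 and the formula fails (e.g. f(t)=t); part (3) is stated for g(t) ≠ 0. *)

(* Defs.v *)
From Stdlib Require Import Reals.
From Coquelicot Require Import Coquelicot.

Open Scope R_scope.

Definition rcpow (t : R) (w : C) : C :=
  (RtoC (exp (Re w * ln t))
   * (cos (Im w * ln t), sin (Im w * ln t)))%C.

(** Euler's integral of t^(z-1) e^(-t) over (0,+oo), taken componentwise.
    It represents the Gamma function only on the half-plane Re z > 0. *)
Definition Gamma_integrand (z : C) (t : R) : C :=
  (rcpow t (z - 1) * RtoC (exp (- t)))%C.

Definition Gamma (z : C) : C :=
  (RInt_gen (fun t => Re (Gamma_integrand z t)) (at_right 0) (Rbar_locally p_infty),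
   RInt_gen (fun t => Im (Gamma_integrand z t)) (at_right 0) (Rbar_locally p_infty)).

Definition pochhammer (z : C) (s : R) : C :=
  (Gamma (z + RtoC s) / Gamma z)%C.

(** [sum_n u i] is u 0 + ... + u i, so the upper limit i is included. *)
Definition truncH (i : nat) (gamma beta rho delta : C) (p q : R) (z : C) : C :=
  (Gamma beta *
   sum_n (fun k : nat =>
     pochhammer rho (q * INR k) / pochhammer delta (p * INR k)
     * (z ^ k / Gamma (gamma * RtoC (INR k) + beta))) i)%C.

Definition Vpoint (i : nat) (gamma beta rho delta : C) (p q alpha : R)
    (t eps : R) : C :=
  (RtoC t * truncH i gamma beta rho delta p q (RtoC (eps * Rpower t (- alpha))))%C.

(** A function on [0,+oo) is represented by an [f : R -> R] of which only the
    values at nonnegative reals are used.  As the parameters are complex,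
    [Vpoint] may leave [0,+oo), where f is not defined; [Re] is then a default,
    and [alpha_differentiable] demands that this does not happen near eps = 0. *)
Definition Vquotient (i : nat) (gamma beta rho delta : C) (p q alpha : R)
    (f : R -> R) (t eps : R) : R :=
  (f (Re (Vpoint i gamma beta rho delta p q alpha t eps)) - f t) / eps.

Definition alpha_differentiable (i : nat) (gamma beta rho delta : C)
    (p q alpha : R) (f : R -> R) (t : R) : Prop :=
  locally' 0 (fun eps : R =>
    Im (Vpoint i gamma beta rho delta p q alpha t eps) = 0 /\
    0 <= Re (Vpoint i gamma beta rho delta p q alpha t eps)) /\
  ex_finite_lim (Vquotient i gamma beta rho delta p q alpha f t) 0.

Definition Vderivative (i : nat) (gamma beta rho delta : C)
    (p q alpha : R) (f : R -> R) (t : R) : R :=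
  real (Lim (Vquotient i gamma beta rho delta p q alpha f t) 0).

(** Derivative at x of a function with domain D; one-sided at an endpoint of D. *)
Definition is_derive_on (D : R -> Prop) (f : R -> R) (x l : R) : Prop :=
  filterlim (fun y => (f y - f x) / (y - x)) (within D (locally' x)) (locally l).

(* Main.v *)
Require Import Defs.
From Stdlib Require Import Reals Lra.
From Coquelicot Require Import Coquelicot.

(** The difference quotient defining the derivative of f runs along the curve
    [eps |-> t H(eps t^-alpha)].  Finiteness of its limit forces
    [f (t H(eps t^-alpha))] to tend to [f t], so that the classical arguments for
    sums, products, quotients and compositions apply without any continuity
    assumption on f.  In (5), H is a polynomial in eps.  If one of Gamma(beta),
    Gamma(rho), Gamma(delta) were zero, then (as x/0 = 0) H and the right-hand
    side of (5) would both vanish, and existence of the limit would give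
    V f t = 0.  Otherwise the curve passes through t at eps = 0; as its imaginary
    part is zero near 0, its linear coefficient is real, and (5) is the ordinary
    chain rule. *)

(** * Derivatives at 0 along a punctured curve *)

(* Unlike [is_derive h 0 l], the value [y] replaces [h 0], which may differ
   from it. *)
Definition punctured_derive (h : R -> R) (y l : R) : Prop :=
  is_lim (fun e => (h e - y) / e) 0 l.

Lemma locally'_0_neq (P : R -> Prop) :
  (forall e, e <> 0 -> P e) -> locally' 0 P.
Proof.
  intros H; exists (mkposreal 1 Rlt_0_1); intros e _ He; exact (H e He).
Qed.

Lemma is_lim_mult_finite (f g : R -> R) (x : Rbar) (lf lg : R) :
  is_lim f x lf -> is_lim g x lg -> is_lim (fun y => f y * g y) x (lf * lg).
Proof. intros Hf Hg; exact (is_lim_mult f g x lf lg Hf Hg I). Qed.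

(** [h e] is [y] plus the quotient times [e], and a finite limit times [e] tends to 0. *)
Lemma punctured_derive_lim h y l : punctured_derive h y l -> is_lim h 0 y.
Proof.
  intros H.
  apply is_lim_ext_loc with (fun e => y + (h e - y) / e * e).
  { apply locally'_0_neq; intros e He; field; exact He. }
  replace (Finite y) with (Finite (y + l * 0)) by (f_equal; ring).
  apply is_lim_plus'; [apply is_lim_const|].
  apply is_lim_mult_finite; [exact H|apply is_lim_id].
Qed.

Lemma punctured_derive_const y : punctured_derive (fun _ => y) y 0.
Proof.
  apply is_lim_ext with (fun _ => 0); [|apply is_lim_const].
  intros e; unfold Rdiv; ring.
Qed.

Lemma punctured_derive_lin h k y z l m a b :
  punctured_derive h y l -> punctured_derive k z m ->
  punctured_derive (fun e => a * h e + b * k e) (a * y + b * z) (a * l + b * m).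
Proof.
  intros Hh Hk.
  apply is_lim_ext with (fun e => a * ((h e - y) / e) + b * ((k e - z) / e)).
  { intros e; unfold Rdiv; ring. }
  apply is_lim_plus'; apply is_lim_mult_finite; trivial; apply is_lim_const.
Qed.

(** Besides the two quotients, only [h] itself has to converge, which [punctured_derive_lim]
    provides. *)
Lemma punctured_derive_mult h k y z l m :
  punctured_derive h y l -> punctured_derive k z m ->
  punctured_derive (fun e => h e * k e) (y * z) (y * m + z * l).
Proof.
  intros Hh Hk.
  apply is_lim_ext with (fun e => h e * ((k e - z) / e) + z * ((h e - y) / e)).
  { intros e; unfold Rdiv; ring. }
  apply is_lim_plus'; apply is_lim_mult_finite; trivial.
  - exact (punctured_derive_lim _ _ _ Hh).
  - apply is_lim_const.
Qed.

(** [D] admits a one-sided derivative of [f] at an endpoint, provided that [h] stays in [D] near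
    0. *)
Lemma punctured_derive_comp (D : R -> Prop) f h y l m :
  locally' 0 (fun e => D (h e)) ->
  is_derive_on D f y l -> punctured_derive h y m ->
  punctured_derive (fun e => f (h e)) (f y) (l * m).
Proof.
  intros HD Hf Hh.
  (* The slope of f at y, completed by its limit l so that no division by
     zero arises when h takes the value y. *)
  set (s := fun u => if Req_EM_T u y then l else (f u - f y) / (u - y)).
  apply is_lim_ext_loc with (fun e => s (h e) * ((h e - y) / e)).
  { apply locally'_0_neq; intros e He; unfold s.
    destruct (Req_EM_T (h e) y) as [E|E].
    - rewrite E; unfold Rdiv; ring.
    - field; split; [exact He|lra]. }
  apply is_lim_mult_finite; [|exact Hh].
  intros P HP.
  assert (HPl : P l) by exact (locally_singleton _ _ HP).
  specialize (Hf P HP); unfold filtermap, within in Hf.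
  (* [Hf] holds on a full neighbourhood of [y] with [u <> y] as a premise, so it pulls back along
     [h] even if [h] takes the value [y]. *)
  pose proof (punctured_derive_lim _ _ _ Hh _ Hf) as Hev.
  unfold filtermap in *.
  change (locally' 0 (fun e => P (s (h e)))).
  generalize (filter_and _ _ HD Hev); apply filter_imp.
  intros e [De He]; unfold s.
  destruct (Req_EM_T (h e) y) as [E|E]; auto.
Qed.

Lemma is_derive_slope f y l :
  is_derive f y l ->
  filterlim (fun u => (f u - f y) / (u - y)) (locally' y) (locally l).
Proof.
  intros H; apply is_derive_Reals in H.
  intros P [eps HP].
  destruct (H eps (cond_pos eps)) as [d Hd].
  exists d; intros u Hu Huy; apply HP.
  specialize (Hd (u - y)).
  rewrite Rplus_minus in Hd.
  apply Hd; [intros E; apply Huy, Rminus_diag_uniq, E|exact Hu].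
Qed.

Lemma is_derive_on_full f y l :
  is_derive f y l -> is_derive_on (fun _ => True) f y l.
Proof.
  intros H P HP.
  change (locally' y (fun u => True -> P ((f u - f y) / (u - y)))).
  apply filter_imp with (fun u => P ((f u - f y) / (u - y))); [auto|].
  exact (is_derive_slope _ _ _ H P HP).
Qed.

Lemma is_derive_punctured h l : is_derive h 0 l -> punctured_derive h (h 0) l.
Proof.
  intros H; apply is_lim_ext with (fun u => (h u - h 0) / (u - 0)).
  { intros e; rewrite Rminus_0_r; reflexivity. }
  exact (is_derive_slope _ _ _ H).
Qed.

(** The reciprocal is a composition with [Rinv]; as [Rinv] is total, zeros of [k] need no separate
    treatment. *)
Lemma punctured_derive_div h k y z l m : z <> 0 ->
  punctured_derive h y l -> punctured_derive k z m ->
  punctured_derive (fun e => h e / k e) (y / z) ((z * l - y * m) / z ^ 2).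
Proof.
  intros Hz Hh Hk.
  assert (Hi : punctured_derive (fun e => / k e) (/ z) (- 1 / z ^ 2 * m)).
  { apply (punctured_derive_comp (fun _ => True) Rinv k z); trivial.
    - apply locally'_0_neq; trivial.
    - apply is_derive_on_full.
      exact (is_derive_inv (fun u => u) z 1 (is_derive_id z) Hz). }
  replace ((z * l - y * m) / z ^ 2) with (y * (- 1 / z ^ 2 * m) + / z * l)
    by (field; exact Hz).
  exact (punctured_derive_mult _ _ _ _ _ _ Hh Hi).
Qed.

Lemma punctured_derive_unique h y l m :
  punctured_derive h y l -> punctured_derive h y m -> l = m.
Proof.
  intros Hl Hm; apply is_lim_unique in Hl; apply is_lim_unique in Hm; congruence.
Qed.

Lemma punctured_derive_ext_loc h k y l :
  locally' 0 (fun e => h e = k e) ->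
  punctured_derive h y l -> punctured_derive k y l.
Proof.
  intros E; apply is_lim_ext_loc; simpl.
  revert E; apply filter_imp; intros e ->; reflexivity.
Qed.

(** * Polynomials at 0 *)

Lemma is_derive_sum_pow (c : nat -> R) n :
  is_derive (fun e => sum_n (fun k => c k * e ^ k) (S n)) 0 (c 1%nat).
Proof.
  induction n as [|n IH].
  - apply is_derive_ext with (fun e => c 0%nat + c 1%nat * e).
    { intros e; rewrite sum_Sn, sum_O; unfold plus; simpl; ring. }
    auto_derive; [trivial|ring].
  - apply is_derive_ext with
      (fun e => plus (sum_n (fun k => c k * e ^ k) (S n)) (c (S (S n)) * e ^ S (S n))).
    { intros e; rewrite (sum_Sn _ (S n)); reflexivity. }
    replace (c 1%nat) with (c 1%nat + 0) by ring.
    apply @is_derive_plus; [exact IH|].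
    auto_derive; [trivial|simpl; ring].
Qed.

Lemma sum_pow_0 (c : nat -> R) n : sum_n (fun k => c k * 0 ^ k) n = c 0%nat.
Proof.
  induction n as [|n IH].
  - rewrite sum_O; simpl; ring.
  - rewrite sum_Sn, IH; unfold plus; simpl; ring.
Qed.

(** For [i = 0] the sum is the constant [c 0], with no linear term; hence [1 <= i]. *)
Lemma punctured_derive_sum_pow (c : nat -> R) i : (1 <= i)%nat ->
  punctured_derive (fun e => sum_n (fun k => c k * e ^ k) i) (c 0%nat) (c 1%nat).
Proof.
  intros Hi; destruct i as [|n]; [inversion Hi|].
  rewrite <- (sum_pow_0 c (S n)) at 1.
  apply is_derive_punctured with (h := fun e => sum_n (fun k => c k * e ^ k) (S n)).
  apply is_derive_sum_pow.
Qed.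

Lemma Re_sum_n (u : nat -> C) n : Re (sum_n u n) = sum_n (fun k => Re (u k)) n.
Proof.
  induction n as [|n IH].
  - rewrite !sum_O; reflexivity.
  - rewrite !sum_Sn, <- IH; reflexivity.
Qed.

Lemma Im_sum_n (u : nat -> C) n : Im (sum_n u n) = sum_n (fun k => Im (u k)) n.
Proof.
  induction n as [|n IH].
  - rewrite !sum_O; reflexivity.
  - rewrite !sum_Sn, <- IH; reflexivity.
Qed.

(** * The curve as a polynomial with complex coefficients *)

Lemma Cinv_0 : (/ RtoC 0)%C = RtoC 0.
Proof. unfold Cinv, RtoC; simpl; f_equal; unfold Rdiv; ring. Qed.

(** Since zero factors are covered, [Vcoeff_1] can regroup denominators without knowing that Gamma
    values are nonzero. *)
Lemma Cinv_mult (z w : C) : (/ (z * w) = / z * / w)%C.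
Proof.
  destruct (Ceq_dec z 0) as [->|Hz].
  { rewrite Cmult_0_l, Cinv_0; ring. }
  destruct (Ceq_dec w 0) as [->|Hw].
  { rewrite Cmult_0_r, Cinv_0; ring. }
  field; split; assumption.
Qed.

(** The coefficient of [eps ^ k] in [Vpoint]. *)
Definition Vcoeff (gamma beta rho delta : C) (p q alpha t : R) (k : nat) : C :=
  (RtoC t * Gamma beta
   * (pochhammer rho (q * INR k) / pochhammer delta (p * INR k)
      * (RtoC (Rpower t (- alpha)) ^ k / Gamma (gamma * RtoC (INR k) + beta))))%C.

Lemma Vpoint_sum i gamma beta rho delta p q alpha t e :
  Vpoint i gamma beta rho delta p q alpha t e =
  sum_n (fun k => Vcoeff gamma beta rho delta p q alpha t k * RtoC (e ^ k))%C i.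
Proof.
  unfold Vpoint, truncH.
  rewrite Cmult_assoc.
  rewrite <- (sum_n_mult_l (K := C_Ring)).
  apply sum_n_ext; intros k; unfold Vcoeff; change (@mult C_Ring) with Cmult.
  rewrite RtoC_mult, Cpow_mult_l, RtoC_pow; unfold Cdiv.
  match goal with |- ?x = ?y => change (@eq C x y) end; ring.
Qed.

Lemma Re_Vpoint_sum i gamma beta rho delta p q alpha t e :
  Re (Vpoint i gamma beta rho delta p q alpha t e) =
  sum_n (fun k => Re (Vcoeff gamma beta rho delta p q alpha t k) * e ^ k) i.
Proof.
  rewrite Vpoint_sum, Re_sum_n; apply sum_n_ext; intros k; simpl; ring.
Qed.

Lemma Im_Vpoint_sum i gamma beta rho delta p q alpha t e :
  Im (Vpoint i gamma beta rho delta p q alpha t e) =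
  sum_n (fun k => Im (Vcoeff gamma beta rho delta p q alpha t k) * e ^ k) i.
Proof.
  rewrite Vpoint_sum, Im_sum_n; apply sum_n_ext; intros k; simpl; ring.
Qed.

(** Both Pochhammer symbols at 0 are [Gamma z / Gamma z = 1], and [Gamma beta] cancels. *)
Lemma Vcoeff_0 gamma beta rho delta p q alpha t :
  Gamma beta <> 0 -> Gamma rho <> 0 -> Gamma delta <> 0 ->
  Vcoeff gamma beta rho delta p q alpha t 0 = RtoC t.
Proof.
  intros Hb Hr Hd; unfold Vcoeff, pochhammer; simpl INR.
  rewrite !Rmult_0_r, !Cmult_0_r, !Cplus_0_r, Cplus_0_l.
  simpl Cpow; field; repeat split; assumption.
Qed.

Lemma Vcoeff_1 gamma beta rho delta p q alpha t : 0 < t ->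
  Vcoeff gamma beta rho delta p q alpha t 1 =
  (RtoC (Rpower t (1 - alpha)) * Gamma beta * pochhammer rho q
   / (Gamma (gamma + beta) * pochhammer delta p))%C.
Proof.
  intros Ht; unfold Vcoeff; simpl INR.
  rewrite !Rmult_1_r, Cmult_1_r.
  unfold Rminus; rewrite Rpower_plus, Rpower_1, RtoC_mult by exact Ht.
  unfold Cdiv; rewrite Cinv_mult; simpl Cpow; ring.
Qed.

(** * Alpha-derivatives as derivatives along the curve *)

Lemma alpha_differentiable_intro i gamma beta rho delta p q alpha f t v :
  locally' 0 (fun e =>
    Im (Vpoint i gamma beta rho delta p q alpha t e) = 0 /\
    0 <= Re (Vpoint i gamma beta rho delta p q alpha t e)) ->
  punctured_derive
    (fun e => f (Re (Vpoint i gamma beta rho delta p q alpha t e))) (f t) v ->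
  alpha_differentiable i gamma beta rho delta p q alpha f t /\
  Vderivative i gamma beta rho delta p q alpha f t = v.
Proof.
  intros Hdom H; split.
  - split; [exact Hdom|exists v; exact H].
  - exact (f_equal real (is_lim_unique _ _ _ H)).
Qed.

Lemma alpha_differentiable_elim i gamma beta rho delta p q alpha f t :
  alpha_differentiable i gamma beta rho delta p q alpha f t ->
  punctured_derive
    (fun e => f (Re (Vpoint i gamma beta rho delta p q alpha t e))) (f t)
    (Vderivative i gamma beta rho delta p q alpha f t).
Proof. intros [_ H]; exact (Lim_correct' _ _ H). Qed.

(** A constant divided by [e] has a finite limit only if it is 0. This serves both the degenerate
    curve and the imaginary part. *)
Lemma punctured_derive_const_inv z y l :
  punctured_derive (fun _ => z) y l -> l = 0.
Proof.
  intros H.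
  assert (E : z = y).
  { pose proof (is_lim_unique _ _ _ (punctured_derive_lim _ _ _ H)) as E.
    rewrite Lim_const in E; congruence. }
  subst z; exact (punctured_derive_unique _ _ _ _ H (punctured_derive_const y)).
Qed.

Lemma Vcoeff_degenerate gamma beta rho delta p q alpha t k :
  Gamma beta = 0 \/ Gamma rho = 0 \/ Gamma delta = 0 ->
  Vcoeff gamma beta rho delta p q alpha t k = 0.
Proof.
  intros H; unfold Vcoeff, pochhammer, Cdiv.
  (* If [Gamma delta = 0], the symbol in the denominator is itself a division by zero, so [Cinv_0]
     is used twice. *)
  destruct H as [E|[E|E]]; rewrite E, ?Cinv_0, ?Cmult_0_r, ?Cinv_0; ring.
Qed.

Lemma Vpoint_degenerate i gamma beta rho delta p q alpha t e :
  Gamma beta = 0 \/ Gamma rho = 0 \/ Gamma delta = 0 ->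
  Vpoint i gamma beta rho delta p q alpha t e = 0.
Proof.
  intros H; rewrite Vpoint_sum.
  induction i as [|i IH].
  - rewrite sum_O, Vcoeff_degenerate by exact H; ring.
  - rewrite sum_Sn, IH, Vcoeff_degenerate, Cmult_0_l by exact H; apply Cplus_0_l.
Qed.

(** The equation lives in [C] as its coefficient is a complex expression; the domain condition in
    [alpha_differentiable] makes that coefficient real. *)
Lemma Vderivative_Derive i gamma beta rho delta p q alpha f t :
  0 < t -> (1 <= i)%nat ->
  alpha_differentiable i gamma beta rho delta p q alpha f t ->
  ex_derive f t ->
  RtoC (Vderivative i gamma beta rho delta p q alpha f t) =
  (RtoC (Rpower t (1 - alpha)) * Gamma beta * pochhammer rho q
   / (Gamma (gamma + beta) * pochhammer delta p) * RtoC (Derive f t))%C.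
Proof.
  intros Ht Hi Hf Hd.
  pose proof (alpha_differentiable_elim _ _ _ _ _ _ _ _ _ _ Hf) as Hq.
  rewrite <- Vcoeff_1 by exact Ht.
  assert (Hcase : (Gamma beta = 0 \/ Gamma rho = 0 \/ Gamma delta = 0) \/
    (Gamma beta <> 0 /\ Gamma rho <> 0 /\ Gamma delta <> 0)).
  { destruct (Ceq_dec (Gamma beta) 0), (Ceq_dec (Gamma rho) 0),
      (Ceq_dec (Gamma delta) 0); tauto. }
  destruct Hcase as [Hdeg|[Hb [Hr Hdl]]].
  - rewrite (Vcoeff_degenerate _ _ _ _ _ _ _ _ _ Hdeg), Cmult_0_l.
    (* The curve is constantly 0, so the quotient is [(f 0 - f t) / e]. *)
    f_equal; apply (punctured_derive_const_inv (f 0) (f t)).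
    revert Hq; apply is_lim_ext; intros e.
    rewrite Vpoint_degenerate by exact Hdeg; reflexivity.
  - set (c := Vcoeff gamma beta rho delta p q alpha t).
    assert (c0 : c 0%nat = RtoC t) by (apply Vcoeff_0; assumption).
    assert (HRe : punctured_derive
      (fun e => Re (Vpoint i gamma beta rho delta p q alpha t e))
      (Re (c 0%nat)) (Re (c 1%nat))).
    { generalize (punctured_derive_sum_pow (fun k => Re (c k)) i Hi).
      apply is_lim_ext; intros e; rewrite Re_Vpoint_sum; reflexivity. }
    (* Near 0 the imaginary part agrees with the constant 0, which forces [Im (c 1)] to vanish. *)
    assert (HIm : punctured_derive (fun _ => 0) (Im (c 0%nat)) (Im (c 1%nat))).
    { generalize (punctured_derive_sum_pow (fun k => Im (c k)) i Hi).
      apply punctured_derive_ext_loc.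
      generalize (proj1 Hf); apply filter_imp; intros e [E _].
      rewrite <- E, Im_Vpoint_sum; reflexivity. }
    apply punctured_derive_const_inv in HIm.
    rewrite c0 in HRe; change (Re (RtoC t)) with t in HRe.
    assert (Hlim : punctured_derive
      (fun e => f (Re (Vpoint i gamma beta rho delta p q alpha t e))) (f t)
      (Derive f t * Re (c 1%nat))).
    { apply (punctured_derive_comp (fun _ => True) f _ t); [| |exact HRe].
      - apply locally'_0_neq; trivial.
      - apply is_derive_on_full, Derive_correct, Hd. }
    rewrite (punctured_derive_unique _ _ _ _ Hq Hlim).
    replace (c 1%nat) with (RtoC (Re (c 1%nat))).
    + rewrite <- RtoC_mult; f_equal; simpl; ring.
    + rewrite (surjective_pairing (c 1%nat)) at 2; unfold RtoC; f_equal.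
      symmetry; exact HIm.
Qed.

Theorem theorem2 :
  forall (i : nat) (gamma beta rho delta : C) (p q alpha a b : R),
  0 < alpha <= 1 ->
  0 < p -> 0 < q ->
  0 < Re gamma -> 0 < Re beta -> 0 < Re rho -> 0 < Re delta ->
  Re gamma + p >= q ->
  let Vdiff := alpha_differentiable i gamma beta rho delta p q alpha in
  let V := Vderivative i gamma beta rho delta p q alpha in
  forall (f g : R -> R) (t : R),
  0 < t ->
  Vdiff f t ->
  Vdiff g t ->
  (Vdiff (fun x => a * f x + b * g x) t /\
   V (fun x => a * f x + b * g x) t = a * V f t + b * V g t)
  /\
  (Vdiff (fun x => f x * g x) t /\
   V (fun x => f x * g x) t = f t * V g t + g t * V f t)
  /\
  (g t <> 0 ->
   Vdiff (fun x => f x / g x) t /\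
   V (fun x => f x / g x) t = (g t * V f t - f t * V g t) / (g t) ^ 2)
  /\
  (forall c : R, Vdiff (fun _ => c) t /\ V (fun _ => c) t = 0)
  /\
  ((1 <= i)%nat ->
   ex_derive f t ->
   RtoC (V f t) =
   (RtoC (Rpower t (1 - alpha)) * Gamma beta * pochhammer rho q
    / (Gamma (gamma + beta) * pochhammer delta p) * RtoC (Derive f t))%C)
  /\
  (forall (D : R -> Prop) (l : R),
   (forall x : R, 0 <= x -> D (g x)) ->
   is_derive_on D f (g t) l ->
   Vdiff (fun x => f (g x)) t /\
   V (fun x => f (g x)) t = l * V g t).
Proof.
  intros i gamma beta rho delta p q alpha a b _ _ _ _ _ _ _ _ Vdiff V f g t Ht Hf Hg.
  (* The domain condition concerns the curve alone, so the one given with [f] serves every function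
     below. *)
  pose proof (proj1 Hf) as Hdom.
  pose proof (alpha_differentiable_elim _ _ _ _ _ _ _ _ _ _ Hf) as Df.
  pose proof (alpha_differentiable_elim _ _ _ _ _ _ _ _ _ _ Hg) as Dg.
  split; [|split; [|split; [|split; [|split]]]].
  - apply alpha_differentiable_intro; [exact Hdom|].
    exact (punctured_derive_lin _ _ _ _ _ _ a b Df Dg).
  - apply alpha_differentiable_intro; [exact Hdom|].
    exact (punctured_derive_mult _ _ _ _ _ _ Df Dg).
  - intros Hgt; apply alpha_differentiable_intro; [exact Hdom|].
    exact (punctured_derive_div _ _ _ _ _ _ Hgt Df Dg).
  - intros c; apply alpha_differentiable_intro; [exact Hdom|].
    exact (punctured_derive_const c).
  - intros Hi Hd; exact (Vderivative_Derive _ _ _ _ _ _ _ _ _ _ Ht Hi Hf Hd).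
  - intros D l HD Hl; apply alpha_differentiable_intro; [exact Hdom|].
    apply (punctured_derive_comp D f _ (g t)); trivial.
    (* Near 0 the curve stays in the half-line [0 <= x], where [g] takes its values in [D]. *)
    revert Hdom; apply filter_imp; intros e [_ He]; exact (HD _ He).
Qed.
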